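(* Let $A$ be the associative unital $\Bbbk$-algebra generated by $\mathcal X=\{T,x(n),y(n)\mid n\in\mathbb Z\}$ with the set $S$ of defining relations, written as rewriting rules (principal word on the left): $$Tx(n)\to x(n)T-n\,x(n-1),\qquad Ty(n)\to y(n)T-n\,y(n-1)\quad(n\in\mathbb Z);$$ $$x(n)x(m)\to x(m)x(n),\qquad y(n)y(m)\to y(m)y(n)\quad(n>m);$$ $$x(n)y(m)\to y(m)x(n)+[x(n-1),y(m+1)]\quad(n>m+1);$$ $$y(m)x(n)\to x(n)y(m)+[y(m-1),x(n+1)]\quad(m\ge n+1).$$ Let $W$ be the left $A$-module generated by one element $\mathbf 1$ with defining relations $x(n)\mathbf 1=y(n)\mathbf 1=0$ for $n\ge0$, $T\mathbf 1=0$, $x(0)y(-1)\mathbf 1=\mathbf 1$ (this is the vertex algebra $\mathrm{Vert}(\{x,y\},N\mid (x{}_{(0)}y)=\mathbf 1)$ with $N(x,x)=N(y,y)=0$, $N(x,y)=N(y,x)=1$). Then the following relations form a Gröbner–Shirshov basis of the vertex algebra $W$: $$x(n)\mathbf 1\to0,\quad y(n)\mathbf 1\to0\ (n\ge0),\qquad T\mathbf 1\to0,\qquad x(0)y(-1)\mathbf 1\to\mathbf 1,$$ $$y(m)x(m)u\mathbf 1\to x(m)y(m)u\mathbf 1\quad(m\in\mathbb Z),$$ $$x(m+1)y(m)u\mathbf 1\to y(m)x(m+1)u\mathbf 1\quad(m\in\mathbb Z,\ m\ne-1),$$ $$x(0)y(-1)u\mathbf 1\to y(-1)x(0)u\mathbf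 1+u\mathbf 1,$$ where $u$ ranges over all words $u=z_1(n_1)z_2(n_2)\cdots z_k(n_k)$, $k\ge0$, $z_i\in\{x,y\}$, with $n_1\le n_2\le\dots\le n_k<0$ and such that $n_i<n_{i+1}$ whenever $z_i=y$ and $z_{i+1}=x$.
   Context: $\Bbbk$ is a field of characteristic zero; $[a,b]=ab-ba$. Let $A=\Bbbk\langle\mathcal X\mid S\rangle$, where each $f\in S$ is written as $f=\bar f-r(f)$ with a chosen principal word $\bar f\in\mathcal X^*$ (rule $\bar f\to r(f)$). Let $R$ be a set of elements $f=\bar f-r(f)$ of the free left $\Bbbk\langle\mathcal X\rangle$-module $\Bbbk\langle\mathcal X\rangle\mathbf 1$ on one generator, each with a chosen principal part $\bar f=v\mathbf 1$, $v\in\mathcal X^*$. Consider the oriented graph whose vertices are the elements of $\Bbbk\langle\mathcal X\rangle\mathbf 1$ and with an edge $h_1\to h_2$ whenever $h_1$ has a summand $\alpha w$ ($\alpha\in\Bbbk\setminus\{0\}$, $w\in\mathcal X^*\mathbf 1$) and either $w=w_1\bar fw_2\mathbf 1$ with $f\in S$, $w_1,w_2\in\mathcal X^*$, and $h_2=h_1-\alpha w_1fw_2\mathbf 1$, or $w=w_1\bar f$ with $f\in R$, $w_1\in\mathcal X^*$, and $h_2=h_1-\alpha w_1f$. A set $R$ is a Gröbner–Shirshov basis of the one-generated $A$-module $M$ if the elements of $R$ are defining relations of $M$ as an $A$-module and this graph satisfies: (termination) there are no infinite oriented paths; (Diamond condition) for any two edges $h\to h_1$, $h\to h_2$ there are oriented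 paths (possibly of length zero) from $h_1$ and from $h_2$ to a common vertex $g$. For a vertex algebra $V$ generated by a set $X$ with locality bound $N:X\times X\to\mathbb Z_+$, a set of defining relations is called a Gröbner–Shirshov basis of $V$ if, together with the vacuum relations $T\mathbf 1\to 0$, $x(n)\mathbf 1\to0$ ($x\in X$, $n\ge0$), it is a Gröbner–Shirshov basis of $V$ as a one-generated module over $\mathcal A(X,N)$; here $\mathcal A(X,N)$ is generated by $T$ and $x(n)$, $x\in X$, $n\in\mathbb Z$, with relations $[T,x(n)]=-nx(n-1)$ and $\sum_{s=0}^{N(x,y)}(-1)^s\binom{N(x,y)}{s}[x(n-s),y(m+s)]=0$. For the data in the claim $\mathcal A(X,N)=A$. *)

(* Defs.v *)
From HB Require Import structures.
From Stdlib Require Export Relation_Operators.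
From mathcomp Require Export all_boot all_order all_algebra.
From mathcomp Require Export monalg.

Set Implicit Arguments.
Unset Strict Implicit.
Unset Printing Implicit Defensive.

Import Order.TTheory GRing.Theory Num.Theory.
Local Open Scope ring_scope.

(* {malg k[word L]} is the free unital associative algebra k<L>.  It also
   serves as the free left k<L>-module k<L>1 on one generator 1: p stands for
   p1, and in particular the word w stands for w1. *)
Notation word L := {fmonom L}.
Notation freealg k L := {malg k[{fmonom L}]}.

Section Presentations.
Variables (k : fieldType) (L : choiceType).

Inductive two_sided_ideal (rel : freealg k L -> Prop) : freealg k L -> Prop :=
| ideal_0 : two_sided_ideal rel 0
| ideal_add (a f b p : freealg k L) :
    rel f -> two_sided_ideal rel p -> two_sided_ideal rel (a * f * b + p).

Inductive left_ideal (A : algType k) (rel : A -> Prop) : A -> Prop :=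
| left_ideal_0 : left_ideal rel 0
| left_ideal_add (a f p : A) :
    rel f -> left_ideal rel p -> left_ideal rel (a * f + p).

(* phi identifies A with the algebra k<L | rel>. *)
Definition presents_algebra (rel : freealg k L -> Prop)
    (A : algType k) (phi : {lrmorphism freealg k L -> A}) : Prop :=
  (forall a : A, exists p, phi p = a) /\
  (forall p, phi p = 0 <-> two_sided_ideal rel p).

(* The A-module M is generated by v, with defining relations p v = 0 for
   all p such that rel p. *)
Definition presents_module (rel : freealg k L -> Prop)
    (A : algType k) (phi : {lrmorphism freealg k L -> A})
    (M : lmodType A) (v : M) : Prop :=
  (forall w : M, exists a : A, w = a *: v) /\
  (forall a : A, a *: v = 0 <->
     left_ideal (fun b => exists2 p, rel p & b = phi p) a).

(* A rule w -> r stands for the element w - r with principal word w. *)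
Definition rules := word L -> freealg k L -> Prop.

Definition rules_rel (Q : rules) (p : freealg k L) : Prop :=
  exists w r, Q w r /\ p = << w >> - r.

(* The coefficient alpha of the reduced summand is its whole coefficient in h:
   splitting a summand into several multiples of the same word is not
   allowed, since it would make termination fail as soon as a rule exists. *)
Inductive edge (S R : rules) (h : freealg k L) : freealg k L -> Prop :=
| edge_algebra (w1 f w2 : word L) (r : freealg k L) :
    S f r -> h@_(mmul (mmul w1 f) w2) != 0 ->
    edge S R h (h - h@_(mmul (mmul w1 f) w2) *:
                      (<< w1 >> * (<< f >> - r) * << w2 >>))
| edge_module (w1 f : word L) (r : freealg k L) :
    R f r -> h@_(mmul w1 f) != 0 ->
    edge S R h (h - h@_(mmul w1 f) *: (<< w1 >> * (<< f >> - r))).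

Definition terminating (S R : rules) : Prop :=
  ~ exists h : nat -> freealg k L, forall i, edge S R (h i) (h i.+1).

Definition diamond (S R : rules) : Prop :=
  forall h h1 h2, edge S R h h1 -> edge S R h h2 ->
  exists g, clos_refl_trans _ (edge S R) h1 g /\
            clos_refl_trans _ (edge S R) h2 g.

(* R is a Groebner-Shirshov basis of the A-module M with generator v, where
   A = k<L | S> via phi. *)
Definition module_GS_basis (S : rules)
    (A : algType k) (phi : {lrmorphism freealg k L -> A})
    (M : lmodType A) (v : M) (R : rules) : Prop :=
  [/\ presents_algebra (rules_rel S) phi,
      presents_module (rules_rel R) phi v,
      terminating S R &
      diamond S R].

End Presentations.

(* The alphabet {T} U {x(n) | x in X, n in Z}. *)
Notation modes X := (option (X * int)%type).
Notation modeT := None (only parsing).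
Definition mode (X : choiceType) (x : X) (n : int) : modes X := Some (x, n).

Section VertexAlgebras.
Variables (k : fieldType) (X : choiceType).
Local Notation F := (freealg k (modes X)).

Definition mon (s : seq (modes X)) : F := << FMonom s >>.
Definition genT : F := mon [:: modeT].
Definition gen (x : X) (n : int) : F := mon [:: mode x n].
Definition comm (a b : F) : F := a * b - b * a.

(* The defining relations of the algebra A(X, N). *)
Inductive mode_algebra_rel (N : X -> X -> nat) : F -> Prop :=
| rel_derivation (x : X) (n : int) :
    mode_algebra_rel N (comm genT (gen x n) + n%:~R *: gen x (n - 1))
| rel_locality (x y : X) (n m : int) :
    mode_algebra_rel N
      (\sum_(s < (N x y).+1) ((-1) ^+ s * 'C(N x y, s)%:R) *:
         comm (gen x (n - s%:Z)) (gen y (m + s%:Z))).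

Inductive vacuum_rules : rules k (modes X) :=
| vacuum_T : vacuum_rules (FMonom [:: modeT]) 0
| vacuum_mode (x : X) (n : int) :
    0 <= n -> vacuum_rules (FMonom [:: mode x n]) 0.

(* R is a Groebner-Shirshov basis of the vertex algebra V with vacuum vector v,
   generated by X with locality bound N.  Only the A(X, N)-module structure of
   V is involved; S are the chosen rewriting rules presenting A(X, N). *)
Definition vertex_GS_basis (N : X -> X -> nat) (S : rules k (modes X))
    (A : algType k) (phi : {lrmorphism F -> A})
    (V : lmodType A) (v : V) (R : rules k (modes X)) : Prop :=
  presents_algebra (mode_algebra_rel N) phi /\
  module_GS_basis S phi v (fun w r => vacuum_rules w r \/ R w r).

End VertexAlgebras.

Inductive xy := X_ | Y_.
Definition bool_of_xy (z : xy) : bool := if z is X_ then false else true.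
Definition xy_of_bool (b : bool) : xy := if b then Y_ else X_.
Lemma bool_of_xyK : cancel bool_of_xy xy_of_bool. Proof. by case. Qed.
HB.instance Definition _ := Countable.copy xy (can_type bool_of_xyK).

Definition Nxy (z t : xy) : nat := if z == t then 0%N else 1%N.

Section Claim.
Variable k : fieldType.
Local Notation F := (freealg k (modes xy)).
Local Notation T := (genT k xy).
Local Notation x n := (@gen k xy X_ n).
Local Notation y n := (@gen k xy Y_ n).
Local Notation xm n := (@mode xy X_ n).
Local Notation ym n := (@mode xy Y_ n).
Local Notation wd s := (@FMonom (modes xy) s).

Inductive algebra_rules : rules k (modes xy) :=
| S_Tx (n : int) :
    algebra_rules (wd [:: modeT; xm n]) (x n * T - n%:~R *: x (n - 1))
| S_Ty (n : int) :
    algebra_rules (wd [:: modeT; ym n]) (y n * T - n%:~R *: y (n - 1))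
| S_xx (n m : int) : m < n ->
    algebra_rules (wd [:: xm n; xm m]) (x m * x n)
| S_yy (n m : int) : m < n ->
    algebra_rules (wd [:: ym n; ym m]) (y m * y n)
| S_xy (n m : int) : m + 1 < n ->
    algebra_rules (wd [:: xm n; ym m])
      (y m * x n + comm (x (n - 1)) (y (m + 1)))
| S_yx (n m : int) : n + 1 <= m ->
    algebra_rules (wd [:: ym m; xm n])
      (x n * y m + comm (y (m - 1)) (x (n + 1))).

(* The relations p 1 = 0 defining the module W. *)
Inductive W_rel : F -> Prop :=
| W_x (n : int) : 0 <= n -> W_rel (x n)
| W_y (n : int) : 0 <= n -> W_rel (y n)
| W_T : W_rel T
| W_xy : W_rel (x 0 * y (-1) - 1).

Definition ordered_step (a b : xy * int) : bool :=
  (a.2 <= b.2) && (((a.1 == Y_) && (b.1 == X_)) ==> (a.2 < b.2)).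

Definition ordered_word (u : seq (xy * int)) : bool :=
  sorted ordered_step u && all (fun z => z.2 < 0) u.

Local Notation emb u := (map (@Some (xy * int)) u).

Inductive W_rules : rules k (modes xy) :=
| R_x (n : int) : 0 <= n -> W_rules (wd [:: xm n]) 0
| R_y (n : int) : 0 <= n -> W_rules (wd [:: ym n]) 0
| R_T : W_rules (wd [:: modeT]) 0
| R_xy0 : W_rules (wd [:: xm 0; ym (-1)]) 1
| R_yx (m : int) (u : seq (xy * int)) : ordered_word u ->
    W_rules (wd [:: ym m, xm m & emb u]) (mon k [:: xm m, ym m & emb u])
| R_xy (m : int) (u : seq (xy * int)) : ordered_word u -> m != -1 ->
    W_rules (wd [:: xm (m + 1), ym m & emb u])
      (mon k [:: ym m, xm (m + 1) & emb u])
| R_xy1 (u : seq (xy * int)) : ordered_word u ->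
    W_rules (wd [:: xm 0, ym (-1) & emb u])
      (mon k [:: ym (-1), xm 0 & emb u] + mon k (emb u)).

End Claim.

(* Main.v *)
(* Give x(n) and y(n) the keys 2n and 2n+1.  Every rule replaces a word by words
   that are smaller for the lexicographic order on (number of T's, sum of the
   squared keys, number of inversions), so rewriting terminates and every element
   reduces to a combination of words u 1 with u sorted and of negative modes.
   No critical pair is computed: the Fock space k[x(n), y(n) | n < 0], where
   nonnegative modes act as derivations, satisfies all the relations, and it
   sends the normal words to distinct monomials; two reducts of one element
   thus have the same normal form.
   For the relations to hold in W, the commutator c_p = [x(n), y(p-n)], which
   depends only on p by locality, has to act as delta_(p,-1).  On the vacuum this
   follows from [T, c_p] = -p c_(p-1) in characteristic zero, and it propagates
   to words by [c_p, z(n)] = [c_(p-j), z(n+j)] for large j. *)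
Require Import Defs.
From mathcomp Require Import all_boot all_order all_algebra.
From mathcomp Require Import monalg finmap zify ring.
From Stdlib Require Import Wellfounded.

Set Implicit Arguments.
Unset Strict Implicit.
Unset Printing Implicit Defensive.

Import Order.TTheory GRing.Theory Num.Theory.
Local Open Scope fset_scope.
Local Open Scope ring_scope.

(** * Termination of linear rewriting *)

Lemma mulU (k : fieldType) (K : monomType) (m m' : K) :
  << m >> * << m' >> = << mmul m m' >> :> {malg k[K]}.
Proof. by have := fgmulUU (1 : k) 1 m m'; rewrite mulr1. Qed.

(* The analogue for finite sets of the multiset extension of lt. *)
Section FsetOrder.
Variables (K : choiceType) (lt : K -> K -> Prop).

Definition fset_lt (B A : {fset K}) : Prop :=
  exists2 w, w \in A /\ w \notin B &
    forall v, v \in B -> v \in A \/ lt v w.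

Lemma Acc_fset_lt_add w :
  (forall v, lt v w -> forall A, Acc fset_lt A -> Acc fset_lt (v |` A)) ->
  forall A, Acc fset_lt A -> Acc fset_lt (w |` A).
Proof.
move=> IHw A; elim=> {}A accA IHA; constructor=> B [v [vA vB] leB].
have B_lt : v \in A -> (forall u, u \in B -> u != w) -> fset_lt B A.
  move=> vA' Bw; exists v => // u uB; case: (leB u uB); last by right.
  by rewrite in_fset1U (negbTE (Bw u uB)) /=; left.
case: (boolP (w \in B)) => wB.
(* Here the pivot [v] differs from [w], so it lies in [A] and shows that [B] without [w] is below
   [A]. *)
- rewrite -(fsetD1K wB); apply: IHA; exists v.
    rewrite in_fsetD1 (negbTE vB) andbF; split=> //.
    by move: vA; rewrite in_fset1U => /orP[/eqP vw|//]; rewrite vw wB in vB.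
  move=> u; rewrite in_fsetD1 => /andP[uw uB].
  by case: (leB u uB); [rewrite in_fset1U (negbTE uw); left|right].
- have Bw u : u \in B -> u != w by apply: contraTneq => ->.
  move: vA; rewrite in_fset1U => /orP[/eqP vw|vA]; last exact/accA/B_lt.
  subst v.
  (* The intersection is either [A] itself or below [A], any lost element serving as pivot. *)
  have accI : Acc fset_lt (B `&` A).
    case: (boolP (A `<=` B `&` A)) => [sAB|/fsubsetPn[u uA uB]].
      have -> : B `&` A = A by apply/eqP; rewrite eqEfsubset fsubsetIr.
      by constructor.
    by apply: accA; exists u => // x; rewrite in_fsetI => /andP[_]; left.
  (* Elements of [B] outside [A] are all below [w]; they are put back one at a time. *)
  have : forall s : seq K, (forall u, u \in s -> lt u w) ->
      Acc fset_lt (foldr (fun u C => u |` C) (B `&` A) s).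
    elim=> [|u s IHs] ltw; first exact: accI.
    apply: IHw; first by apply: ltw; rewrite inE eqxx.
    by apply: IHs => u' u's; apply: ltw; rewrite inE u's orbT.
  move/(_ [seq u <- enum_fset B | u \notin A]).
  set C := foldr _ _ _; have -> : C = B.
    rewrite {}/C; apply/fsetP=> x.
    have -> s : (x \in foldr (fun u C => u |` C) (B `&` A) s)
      = (x \in s) || (x \in B `&` A).
      by elim: s => //= u s IHs; rewrite in_fset1U IHs inE orbA.
    rewrite mem_filter in_fsetI.
    by case: (x \in A); rewrite ?andbT ?andbF ?orbF.
  apply=> u; rewrite mem_filter => /andP[uA uB]; case: (leB u uB) => //.
  by rewrite in_fset1U (negbTE uA) (negbTE (Bw u uB)).
Qed.

Lemma wf_fset_lt : well_founded lt -> well_founded fset_lt.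
Proof.
move=> wf_lt A.
have add w B : Acc fset_lt B -> Acc fset_lt (w |` B).
  by move: B; elim/(well_founded_ind wf_lt): w => w; apply: Acc_fset_lt_add.
elim/fset1U_rect: A => [|w A _ accA]; last exact: add.
by constructor=> B [w []]; rewrite in_fset0.
Qed.

End FsetOrder.

(** * Rewriting with rules that decrease a well-founded order on words *)

Section LinearRewriting.
Variables (k : fieldType) (L : choiceType) (S R : rules k L).
Local Notation F := (freealg k L).
Local Notation "h ->* g" := (clos_refl_trans _ (edge S R) h g) (at level 70).

Lemma msuppUM (w v : word L) (p : F) :
  v \in msupp (<< w >> * p) -> exists2 u, u \in msupp p & v = mmul w u.
Proof.
by case/msuppM_le=> a [u [+ up ->]]; rewrite msuppU1 inE => /eqP->; exists u.
Qed.

Lemma msuppMU (w v : word L) (p : F) :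
  v \in msupp (p * << w >>) -> exists2 u, u \in msupp p & v = mmul u w.
Proof.
by case/msuppM_le=> u [a [up + ->]]; rewrite msuppU1 inE => /eqP->; exists u.
Qed.

Variable lt : word L -> word L -> Prop.
Hypothesis wf_lt : well_founded lt.
Hypothesis S_lt : forall w1 f w2 r g, S f r -> g \in msupp r ->
  lt (mmul (mmul w1 g) w2) (mmul (mmul w1 f) w2).
Hypothesis R_lt : forall w1 f r g, R f r -> g \in msupp r ->
  lt (mmul w1 g) (mmul w1 f).

Lemma wf_irrefl w : ~ lt w w.
Proof. by elim/(well_founded_ind wf_lt): w => w IHw ltw; apply: (IHw w). Qed.

(** The pivot is [w]: by irreflexivity it is absent from [msupp r], so subtracting with its whole
    coefficient cancels it, and all new words lie below it. *)
Lemma step_lt (h r : F) (w : word L) : h@_w != 0 ->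
  (forall g, g \in msupp r -> lt g w) ->
  fset_lt lt (msupp (h - h@_w *: (<< w >> - r))) (msupp h).
Proof.
move=> hw r_lt; exists w.
  split; first by rewrite -mcoeff_neq0.
  rewrite -mcoeff_eq0 mcoeffB mcoeffZ mcoeffB mcoeffUU (@mcoeff_outdom _ _ r).
    by rewrite subr0 mulr1 subrr.
  by apply/negP=> /r_lt/wf_irrefl.
move=> v /(fsubsetP (msuppB_le _ _)); rewrite in_fsetU.
case/orP; first by left.
move/(fsubsetP (msuppZ_le _ _))/(fsubsetP (msuppB_le _ _)).
rewrite in_fsetU msuppU1 inE => /orP[/eqP->|/r_lt]; last by right.
by left; rewrite -mcoeff_neq0.
Qed.

Lemma edge_lt h g : edge S R h g -> fset_lt lt (msupp g) (msupp h).
Proof.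
case=> [w1 f w2 r Sfr|w1 f r Rfr] hw.
- rewrite mulrBr mulrBl !mulU; apply: step_lt => // v.
  by case/msuppMU=> u /msuppUM[x xr ->] ->; apply: S_lt Sfr xr.
- rewrite mulrBr !mulU; apply: step_lt => // v /msuppUM[u ur ->].
  exact: R_lt Rfr ur.
Qed.

Lemma wf_edge : well_founded (fun g h => edge S R h g).
Proof.
apply: (wf_incl _ _ (fun g h : F => fset_lt lt (msupp g) (msupp h))).
  by move=> g h; apply: edge_lt.
exact: wf_inverse_image (wf_fset_lt wf_lt).
Qed.

Lemma terminating_of_lt : terminating S R.
Proof.
case=> h edge_h.
have : forall p, Acc (fun g h => edge S R h g) p -> forall i, h i <> p.
  move=> p; elim=> {}p _ IHp i hip.
  by apply: (IHp (h i.+1) _ i.+1); rewrite -?hip.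
by move/(_ (h 0%N) (wf_edge _) 0%N).
Qed.

Variable normal : pred (word L).
Hypothesis reducible : forall w, ~~ normal w ->
  (exists w1 f w2 r, S f r /\ w = mmul (mmul w1 f) w2) \/
  (exists w1 f r, R f r /\ w = mmul w1 f).

Lemma normal_form h : exists2 g, h ->* g & all normal (msupp g).
Proof.
elim/(well_founded_ind wf_edge): h => h IHh.
case: (boolP (all normal (msupp h))) => [|/allPn[w wh /reducible red]].
  by exists h => //; apply: rt_refl.
have [h1 e] : exists h1, edge S R h h1.
  rewrite -mcoeff_neq0 in wh.
  case: red => [[w1 [f [w2 [r [Sfr defw]]]]]|[w1 [f [r [Rfr defw]]]]];
    rewrite defw in wh.
  - by eexists; apply: edge_algebra Sfr wh.
  - by eexists; apply: edge_module Rfr wh.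
have [g h1g ng] := IHh h1 e; exists g => //.
by apply: rt_trans h1g; apply: rt_step.
Qed.

(** The common vertex is a normal form: those of [h1] and [h2] have the same value under [ev], and
    their difference is again supported on normal words, where [ev] is injective. *)
Lemma diamond_of_invariant (V : zmodType) (ev : F -> V) :
  (forall p q, ev (p - q) = ev p - ev q) ->
  (forall h g, edge S R h g -> ev h = ev g) ->
  (forall h, all normal (msupp h) -> ev h = 0 -> h = 0) ->
  diamond S R.
Proof.
move=> evB ev_edge ev_inj h h1 h2 e1 e2.
have ev_path p q : p ->* q -> ev p = ev q.
  by elim=> {p q} [p q /ev_edge|//|p q r _ -> _].
have [g1 p1 n1] := normal_form h1; have [g2 p2 n2] := normal_form h2.
exists g1; split=> //; suff -> : g1 = g2 by [].
apply/eqP; rewrite -subr_eq0; apply/eqP/ev_inj.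
  apply/allP=> w /(fsubsetP (msuppB_le _ _)); rewrite in_fsetU.
  by case/orP=> [/(allP n1)|/(allP n2)].
rewrite evB -(ev_path _ _ p1) -(ev_path _ _ p2).
by rewrite -(ev_edge _ _ e1) -(ev_edge _ _ e2) subrr.
Qed.

End LinearRewriting.

(** * The order on words *)

Section Monomials.
Variables (k : fieldType) (X : choiceType).

Lemma monM (s t : seq (modes X)) : mon k s * mon k t = mon k (s ++ t).
Proof. by rewrite /mon mulU -[mmul _ _]fmK fmM. Qed.

Lemma mon_nil : mon k ([::] : seq (modes X)) = 1.
Proof. by rewrite /mon -[in RHS]mpolyC1E -fm1 fmK. Qed.

Lemma msupp_mon (s : seq (modes X)) g : g \in msupp (mon k s) -> g = FMonom s.
Proof. by rewrite msuppU1 inE => /eqP. Qed.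

Lemma in_msuppD (p q : freealg k (modes X)) g :
  g \in msupp (p + q) -> g \in msupp p \/ g \in msupp q.
Proof. by move/(fsubsetP (msuppD_le _ _)); rewrite in_fsetU => /orP. Qed.

Lemma in_msuppB (p q : freealg k (modes X)) g :
  g \in msupp (p - q) -> g \in msupp p \/ g \in msupp q.
Proof. by move/(fsubsetP (msuppB_le _ _)); rewrite in_fsetU => /orP. Qed.

Lemma msupp_mon2 (a b : modes X) g :
  g \in msupp (mon k [:: a] * mon k [:: b]) -> g = FMonom [:: a; b].
Proof. by rewrite monM; apply: msupp_mon. Qed.

Lemma msupp_comm (a b : modes X) g :
  g \in msupp (comm (mon k [:: a]) (mon k [:: b])) ->
  g = FMonom [:: a; b] \/ g = FMonom [:: b; a].
Proof. by case/in_msuppB=> /msupp_mon2; [left|right]. Qed.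

Lemma in_msuppZ c (p : freealg k (modes X)) g :
  g \in msupp (c *: p) -> g \in msupp p.
Proof. exact/fsubsetP/msuppZ_le. Qed.

Lemma eq_mmul (w v u : word (modes X)) :
  w = v ++ u :> seq _ -> w = mmul v u.
Proof. by move=> e; apply/eqP; rewrite fmP fmM e. Qed.

Lemma eq_mmul3 (w v u t : word (modes X)) :
  w = v ++ u ++ t :> seq _ -> w = mmul (mmul v u) t.
Proof. by move=> e; apply/eqP; rewrite fmP !fmM -catA e. Qed.

End Monomials.

Section WordOrder.
Implicit Types (a b : modes xy) (s t f g : seq (modes xy)).

(* The letters ordered as x(n) < y(n) < x(n+1). *)
Definition key (z : xy * int) : int := z.2 * 2 + (z.1 == Y_)%:Z.

(** [T] counts as the greatest letter, so moving it right past a mode removes an inversion. *)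
Definition letter_gt a b : bool :=
  match a, b with
  | _, None => false
  | None, Some _ => true
  | Some c, Some d => key d < key c
  end.

Definition sqkey a : nat := if a is Some c then (`|key c| ^ 2)%N else 0%N.

Definition degT s : nat := count_mem None s.
Definition sqsum s : nat := (\sum_(a <- s) sqkey a)%N.
Fixpoint inversions s : nat :=
  if s is a :: s' then (count (letter_gt a) s' + inversions s')%N else 0%N.

(** The third clause asks for a permutation, not merely for equal degrees and sums: then both words
    form equally many inversions with any context, and the order is stable under contexts. *)
Definition seq_lt g f : bool :=
  [|| degT g < degT f, (degT g == degT f) && (sqsum g < sqsum f)
    | perm_eq g f && (inversions g < inversions f)]%N.

Definition word_lt (v w : word (modes xy)) : Prop := seq_lt v w.

Lemma wf_word_lt : well_founded word_lt.
Proof.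
pose lex := slexprod nat nat Peano.lt Peano.lt.
pose lex3 := slexprod nat (nat * nat) Peano.lt lex.
pose mu (w : word (modes xy)) := (degT w, (sqsum w, inversions w)).
apply: (wf_incl _ _ (fun v w => lex3 (mu v) (mu w))) => [v w|].
  case/or3P=> [lt_vw|/andP[/eqP eq_vw lt_vw]|/andP[eq_vw lt_vw]].
  - by left; apply/ssrnat.ltP.
  - by rewrite /mu eq_vw; right; left; apply/ssrnat.ltP.
  - rewrite /mu /degT /sqsum (permP eq_vw) (perm_big _ eq_vw) /=.
    by right; right; apply/ssrnat.ltP.
apply: wf_inverse_image; apply: wf_slexprod; first exact: PeanoNat.Nat.lt_wf_0.
by apply: wf_slexprod; apply: PeanoNat.Nat.lt_wf_0.
Qed.

Lemma inversions_catl s g f : perm_eq g f -> (inversions g < inversions f)%N ->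
  (inversions (s ++ g) < inversions (s ++ f))%N.
Proof.
move=> eq_gf lt_gf; elim: s => //= a s IHs.
by rewrite !count_cat (permP eq_gf) -!addnA ltn_add2l ltn_add2l.
Qed.

Lemma inversions_catr s g f : perm_eq g f -> (inversions g < inversions f)%N ->
  (inversions (g ++ s) < inversions (f ++ s))%N.
Proof.
have inv_cat t : inversions (t ++ s)
    = (inversions t + (\sum_(a <- t) count (letter_gt a) s + inversions s))%N.
  elim: t => [|a t IHt] /=; first by rewrite big_nil.
  by rewrite IHt count_cat big_cons; lia.
by move=> eq_gf lt_gf; rewrite !inv_cat (perm_big _ eq_gf) ltn_add2r.
Qed.

Lemma seq_lt_context s t g f : seq_lt g f -> seq_lt (s ++ g ++ t) (s ++ f ++ t).
Proof.
rewrite /seq_lt /degT /sqsum !count_cat !big_cat /=.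
case/or3P=> [lt_gf|/andP[/eqP-> lt_gf]|/andP[eq_gf lt_gf]].
- by rewrite ltn_add2l ltn_add2r lt_gf.
- by rewrite eqxx !ltn_add2l !ltn_add2r lt_gf orbT.
- rewrite perm_cat2l perm_cat2r eq_gf inversions_catl ?orbT //.
    by rewrite perm_cat2r.
  exact: inversions_catr.
Qed.

Lemma seq_lt_contextr t g f : seq_lt g f -> seq_lt (g ++ t) (f ++ t).
Proof. exact: (@seq_lt_context [::]). Qed.

Lemma seq_lt_swap a b s : letter_gt a b -> seq_lt [:: b, a & s] [:: a, b & s].
Proof.
move=> gt_ab; apply: (@seq_lt_contextr s [:: b; a] [:: a; b]).
apply/or3P/Or33; rewrite (perm_catC [:: b] [:: a]) /= gt_ab perm_refl.

by case: a b gt_ab => [a|] [b|] //= gt_ab; rewrite (lt_gtF gt_ab).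
Qed.

(** Moving the two keys towards each other by 2 changes the sum of squares by
    [8 - 4 * (key a - key b)], which is negative from distance 3 on. *)
Lemma seq_lt_sq (a b c d : xy * int) : key c = key a - 2 -> key d = key b + 2 ->
  key b + 3 <= key a ->
  seq_lt [:: Some c; Some d] [:: Some a; Some b] &&
  seq_lt [:: Some d; Some c] [:: Some a; Some b].
Proof.
move=> eq_c eq_d gt_ab.
suff lt_sq :
    (sqkey (Some c) + sqkey (Some d) < sqkey (Some a) + sqkey (Some b))%N.
  rewrite /seq_lt /sqsum !big_cons !big_nil !addn0 (addnC (sqkey (Some d))).
  by rewrite lt_sq.
rewrite /= eq_c eq_d -!mulnn.
nia.
Qed.

End WordOrder.

(** * The rewriting rules *)

Section Rules.
Variable k : fieldType.
Local Notation S := (@algebra_rules k).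
Local Notation R := (fun w r => vacuum_rules w r \/ @W_rules k w r).

(** Swapped words lose an inversion, the term without [T] has smaller degree in [T], and commutator
    terms have a smaller sum of squares: the keys on the left differ by [2(n - m) - 1] or
    [2(m - n) + 1], both at least 3 under the side conditions. *)
Lemma algebra_rules_lt f r g : S f r -> g \in msupp r -> word_lt g f.
Proof.
case=> {f r} [n|n|n m lt_mn|n m lt_mn|n m lt_mn|n m le_nm].
- case/in_msuppB=> [/msupp_mon2->|/in_msuppZ/msupp_mon->] //.
  exact: seq_lt_swap.
- case/in_msuppB=> [/msupp_mon2->|/in_msuppZ/msupp_mon->] //.
  exact: seq_lt_swap.
- by move/msupp_mon2->; apply: seq_lt_swap; rewrite /= /key /=; lia.
- by move/msupp_mon2->; apply: seq_lt_swap; rewrite /= /key /=; lia.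
-  case/in_msuppD=> [/msupp_mon2->|].
    by apply: seq_lt_swap; rewrite /= /key /=; lia.
  have /andP[lt1 lt2] : seq_lt [:: mode X_ (n - 1); mode Y_ (m + 1)]
        [:: mode X_ n; mode Y_ m] &&
      seq_lt [:: mode Y_ (m + 1); mode X_ (n - 1)] [:: mode X_ n; mode Y_ m].
    by apply: seq_lt_sq; rewrite /key /=; lia.
  by case/msupp_comm=> ->.
-  case/in_msuppD=> [/msupp_mon2->|].
    by apply: seq_lt_swap; rewrite /= /key /=; lia.
  have /andP[lt1 lt2] : seq_lt [:: mode Y_ (m - 1); mode X_ (n + 1)]
        [:: mode Y_ m; mode X_ n] &&
      seq_lt [:: mode X_ (n + 1); mode Y_ (m - 1)] [:: mode Y_ m; mode X_ n].
    by apply: seq_lt_sq; rewrite /key /=; lia.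
  by case/msupp_comm=> ->.
Qed.

Lemma module_rules_lt f r g : R f r -> g \in msupp r -> word_lt g f.
Proof.
(* [x(0)] has key 0 and [y(-1)] has key -1, so erasing both lowers the sum of squares by 1. *)
have sq_lt u : seq_lt u [:: mode X_ 0, mode Y_ (-1) & u].
  apply: (@seq_lt_contextr u [::] [:: mode X_ 0; mode Y_ (-1)]).
  by rewrite /seq_lt /sqsum !big_cons !big_nil.
case=> [[|z n _]|]; rewrite ?msupp0 ?in_fset0 //.
case=> [n _|n _|||m u _|m u _ _|u _]; rewrite ?msupp0 ?in_fset0 //.
- by rewrite -mon_nil => /msupp_mon->; apply: sq_lt.
- by move/msupp_mon->; apply: seq_lt_swap; rewrite /= /key /=; lia.
- by move/msupp_mon->; apply: seq_lt_swap; rewrite /= /key /=; lia.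
- case/in_msuppD=> /msupp_mon->; last exact: sq_lt.
  by apply: seq_lt_swap; rewrite /= /key /=; lia.
Qed.

Lemma word_lt_context w1 w2 f g :
  word_lt g f -> word_lt (mmul (mmul w1 g) w2) (mmul (mmul w1 f) w2).
Proof. by rewrite /word_lt !fmM -!catA; apply: seq_lt_context. Qed.

Definition normal_word (w : seq (modes xy)) : bool :=
  all isSome w && ordered_word (pmap id w).

Lemma normal_wordP (w : seq (modes xy)) :
  reflect (exists2 u, ordered_word u & w = map (@Some _) u) (normal_word w).
Proof.
apply: (iffP andP) => [[someW ordW]|[u ordu ->]].
  exists (pmap id w) => //; elim: w someW {ordW} => //= -[a|] //= w IHw /IHw.
  by move=> {1}->.
by rewrite map_pK // all_map; split=> //; apply/allP.
Qed.

Lemma ordered_word_cons a u :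
  ordered_word (a :: u) = [&& path ordered_step a u, a.2 < 0 & ordered_word u].
Proof.
rewrite /ordered_word /=; case: u => [|b u] /=; first by rewrite andbT.
by rewrite [_ && path _ _ _]andbC; case: path; rewrite /= ?andbF ?andbT.
Qed.

(** By induction the tail after the first letter may be taken normal, so a redex starts at the first
    letter. An algebra rule may leave any suffix, while a module rule has to match the whole word;
    its tail [u] is ordered because the word's tail is. *)
Lemma seq_reducible (w : seq (modes xy)) : ~~ normal_word w ->
  (exists w1 f w2 r, S f r /\ w = w1 ++ f ++ w2) \/
  (exists w1 f r, R f r /\ w = w1 ++ f).
Proof.
elim: w => // a w IHw; case: (boolP (normal_word w)) => [|/IHw]; last first.
  case=> [[w1 [f [w2 [r [Sfr ->]]]]]|[w1 [f [r [Rfr ->]]]]] _.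
  - by left; exists (a :: w1), f, w2, r.
  - by right; exists (a :: w1), f, r.
case/normal_wordP=> u ordu {IHw w}->.
have byS b r s : S (FMonom b) r -> a :: map (@Some _) u = b ++ s ->
    (exists w1 f w2 r, S f r /\ a :: map (@Some _) u = w1 ++ f ++ w2) \/
    (exists w1 f r, R f r /\ a :: map (@Some _) u = w1 ++ f).
  by left; exists [::], (FMonom b), s, r.
have byR b r : R (FMonom b) r -> a :: map (@Some _) u = b ->
    (exists w1 f w2 r, S f r /\ a :: map (@Some _) u = w1 ++ f ++ w2) \/
    (exists w1 f r, R f r /\ a :: map (@Some _) u = w1 ++ f).
  by right; exists [::], (FMonom b), r.
case: a byS byR => [a|] byS byR; last first.
  move=> _; case: u ordu byS byR => [|[[] n] u] ordu byS byR.
  - by apply: byR; first by left; constructor.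
  - by apply: byS; first exact: S_Tx.
  - by apply: byS; first exact: S_Ty.
move=> nred.
have {nred} : ~~ ordered_word (a :: u).
  by apply: contra nred => ord; apply/normal_wordP; exists (a :: u).
rewrite ordered_word_cons ordu andbT.
case: u ordu byS byR => [|b u] ordu byS byR.
  case: a byS byR => z n byS byR; rewrite /= -leNgt => n_ge0.
  by apply: byR; first by left; constructor; apply: n_ge0.
move: ordu; rewrite ordered_word_cons => /and3P[/= ordb b_lt0 ordu].
(* An ordered step into a negative mode starts from a negative mode, so in both cases it is the step
   from [a] to [b] that fails. *)
rewrite ordb andbT negb_and => nab; have {nab b_lt0} : ~~ ordered_step a b.
  case/orP: nab => //; apply: contra => /andP[le_ab _].
  exact: le_lt_trans le_ab b_lt0.
case: a b ordb byS byR => [[] n] [[] m] ordb byS byR;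
  rewrite /ordered_step /= ?andbT ?andbF -?ltNge => nab.
- by apply: byS; first exact: S_xx nab.
(* The step fails for [m < n] and the algebra rule needs [m + 1 < n]; the gap [n = m + 1] is filled
   by the module rules. *)
- have [lt_mn|le_nm] := ltP (m + 1) n.
    by apply: byS; first exact: (S_xy k lt_mn).
  have {nab le_nm} eq_n : n = m + 1 by lia.
  rewrite {}eq_n in byS byR *.
  have [m1|m_neq] := eqVneq m (-1).
    by rewrite {}m1 in byS byR *; apply: byR; first by right; exact: R_xy1 ordu.
  by apply: byR; first by right; exact: R_xy ordu m_neq.
(* Here the step fails for [m <= n], and the gap left by the algebra rule is [n = m]. *)
- have [le_mn|lt_nm] := leP (m + 1) n.
    by apply: byS; first exact: (S_yx k le_mn).
  have {nab lt_nm} eq_n : n = m by lia.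
  by rewrite {}eq_n in byS byR *; apply: byR; first by right; exact: R_yx ordu.
- by apply: byS; first exact: S_yy nab.
Qed.

End Rules.

(** * Modes acting on the vacuum module *)

Section Commutator.
Variable A : nzRingType.

Definition com (a b : A) : A := a * b - b * a.

Lemma comN a b : - com a b = com b a.
Proof. exact: opprB. Qed.

Lemma com_flip a b c d : com b a = com d c -> com a b = com c d.
Proof. by move=> e; rewrite -comN e comN. Qed.

Lemma com_flip0 a b : com b a = 0 -> com a b = 0.
Proof. by move=> e; rewrite -comN e oppr0. Qed.

Lemma comrN a b : com a (- b) = - com a b.
Proof. by rewrite /com mulrN mulNr opprB opprK addrC. Qed.

Lemma com_leibniz a b c : com a (com b c) = com (com a b) c + com b (com a c).
Proof.
rewrite /com !(mulrBr, mulrBl, mulrA) !opprB !addrA.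
rewrite [RHS](ACl (1*8*3*6*(2*5)*(4*7))%AC) /= !addNr !addr0.
by [].
Qed.

End Commutator.

Section ModeOperators.
Variables (k : fieldType) (A : algType k) (op : xy -> int -> A) (T : A).
Hypothesis com_same : forall z n m, com (op z n) (op z m) = 0.
Hypothesis com_xy_step : forall n m,
  com (op X_ n) (op Y_ m) = com (op X_ (n - 1)) (op Y_ (m + 1)).
Hypothesis com_T : forall z n, com T (op z n) = - (n%:~R *: op z (n - 1)).

(** The representative of c_p with first index 0. *)
Definition xycom (p : int) : A := com (op X_ 0) (op Y_ p).

Lemma com_xy n m : com (op X_ n) (op Y_ m) = xycom (n + m).
Proof.
have step (i : nat) (a b : int) :
    com (op X_ a) (op Y_ b) = com (op X_ (a - i%:Z)) (op Y_ (b + i%:Z)).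
  elim: i a b => [|i IHi] a b; first by rewrite subr0 addr0.
  by rewrite IHi com_xy_step; congr (com (op _ _) (op _ _)); lia.
case: n => n; first by rewrite (step n) subrr addrC.
(* For a negative first index the chain of locality steps starts at 0 and runs down to it. *)
by rewrite /xycom [RHS](step n.+1) NegzE; congr (com (op _ _) (op _ _)); lia.
Qed.

Lemma com_T_xycom p : com T (xycom p) = - (p%:~R *: xycom (p - 1)).
Proof.
rewrite /xycom com_leibniz !com_T scale0r oppr0 {1}/com mul0r mulr0 subr0 add0r.
by rewrite /com mulrN mulNr -scalerAl -scalerAr opprK scalerBr opprB addrC.
Qed.

(** Write c_p with [z(m + j)] as one of its factors. Since [z(m)] commutes with [z(m + j)], the
    Jacobi identity lets the two modes change places, and [z(m)] enters the inner commutator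
    c_(p-j). *)
Lemma com_op_xycom z m p j :
  com (op z m) (xycom p) = com (op z (m + j)) (xycom (p - j)).
Proof.
case: z.
  have -> : xycom p = com (op X_ (m + j)) (op Y_ (p - j - m)).
    by rewrite com_xy; congr xycom; lia.
  rewrite com_leibniz com_same {1}/com mul0r mulr0 subrr add0r com_xy.
  by congr (com _ (xycom _)); lia.
have -> : xycom p = com (op X_ (p - j - m)) (op Y_ (m + j)).
  by rewrite com_xy; congr xycom; lia.
rewrite com_leibniz com_same [X in _ + X]/com mul0r mulr0 subrr addr0.
rewrite -[com (op Y_ m) _]comN com_xy -comN comrN opprK.
by congr (com _ (xycom _)); lia.
Qed.

Variables (W : lmodType A) (one : W).
Hypothesis char0 : [pchar k] =i pred0.
Hypothesis op_vac : forall z n, 0 <= n -> op z n *: one = 0.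
Hypothesis T_vac : T *: one = 0.
Hypothesis xy_vac : (op X_ 0 * op Y_ (-1)) *: one = one.

(** For [p >= 0] both products apply a nonnegative mode to the vacuum first. The value at -1 is the
    relation [xy_vac], and below -1 one descends by [T, c_p] = -p c_(p-1), dividing by a positive
    integer. *)
Lemma xycom_vac p : xycom p *: one = (p == -1)%:R *: one.
Proof.
have [p_ge0|] := leP 0 p.
  rewrite scalerBl -!scalerA !op_vac // !scaler0 subr0.
  have /negbTE-> : p != -1 by lia.
  by rewrite scale0r.
case: p => // n _; rewrite NegzE; elim: n => [|n IHn].
  by rewrite eqxx scale1r scalerBl xy_vac -scalerA op_vac // scaler0 subr0.
have /negbTE-> : - n.+2%:Z != -1 by lia.
rewrite scale0r.
have n_neq0 : n.+1%:R != 0 :> k by rewrite (proj1 (pcharf0P k) char0).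
have -> : xycom (- n.+2%:Z) = (n.+1%:R^-1)%:A * com T (xycom (- n.+1%:Z)).
  rewrite com_T_xycom -scaleNr mulr_algl scalerA mulrNz opprK.
  by rewrite mulVf // scale1r; congr xycom; lia.
rewrite -scalerA scalerBl -!scalerA T_vac scaler0 subr0 IHn.
by case: eqP => _; rewrite ?scale1r ?scale0r ?T_vac !scaler0.
Qed.

(* Truncation makes the second clause propagate along words: in
   [c_p, z(n)] = [c_(p-j), z(n+j)] the right-hand side kills w for j large. *)
Definition regular (w : W) : Prop :=
  (exists N, forall n z, N <= n -> op z n *: w = 0) /\
  (forall p, xycom p *: w = (p == -1)%:R *: w).

Lemma regular_op z n w : regular w -> regular (op z n *: w).
Proof.
case=> [[N trunc] xycom_w].
have comm_op a b v : a *: (b *: v) = com a b *: v + b *: (a *: v) :> W.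
  by rewrite scalerBl !scalerA subrK.
have xycom_w0 p : 0 <= p -> xycom p *: w = 0.
  move=> p_ge0; rewrite xycom_w; have /negbTE-> : p != -1 by lia.
  by rewrite scale0r.
split=> [|p].
  (* The bound [N] makes [t(m)] kill [w]; the bound [- n] gives [m + n >= 0], so that c_(m+n) kills
     [w] as well. *)
  exists (Num.max N (- n)) => m t; rewrite ge_max => /andP[le_Nm le_nm].
  rewrite comm_op (trunc m) // scaler0 addr0.
  have mn_ge0 : 0 <= m + n by lia.
  case: z t => [] []; rewrite ?com_same ?scale0r //.
    by rewrite -comN com_xy scaleNr addrC xycom_w0 ?oppr0.
  by rewrite com_xy xycom_w0.
(* The shift [N - n] turns [z(n)] into [z(N)], which kills [w]; the shifted c acts on [w] by a
   scalar, so the commutator vanishes on [w]. *)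
rewrite comm_op -comN (com_op_xycom z n p (N - n)) [n + _]addrC subrK comN.
have boolC (b : bool) a v : a *: (b%:R *: v) = b%:R *: (a *: v) :> W.
  by case: b; rewrite ?scale1r ?scale0r ?scaler0.
rewrite scalerBl -!scalerA (trunc N) // !xycom_w !boolC (trunc N) //.
by rewrite !scaler0 subrr add0r.
Qed.

Lemma regular_word (u : seq (xy * int)) :
  regular (foldr (fun z v => op z.1 z.2 *: v) one u).
Proof.
elim: u => [|z u IHu] /=; last exact: regular_op.
by split; [exists 0 => n z; apply: op_vac | apply: xycom_vac].
Qed.

End ModeOperators.

(** * The presentations *)

(* Identities are proved over abstract rings wherever possible: in {malg k[K]}
   the failing comparison of two distinct monomials, attempted by rewrite, is
   intractable. *)
Lemma mul_add_mul (R : nzRingType) (a b c d f p : R) :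
  a * (c * f * d + p) * b = (a * c) * f * (d * b) + a * p * b.
Proof. by rewrite mulrDr mulrDl !mulrA. Qed.

Section RingMorphism.
Variables (R A : nzRingType) (phi : {rmorphism R -> A}).

Lemma rmorph_com (a b : R) : phi (a * b - b * a) = com (phi a) (phi b).
Proof. by rewrite rmorphB !rmorphM. Qed.

Lemma rmorph_mulB1 (a b : R) : phi (a * b - 1) = phi a * phi b - 1.
Proof. by rewrite rmorphB rmorphM rmorph1. Qed.

Lemma rmorph_swap (a b c r : R) :
  phi (a * (b * c) - (b * (a * c) + r))
    = phi a * (phi b * phi c) - (phi b * (phi a * phi c) + phi r).
Proof. by rewrite rmorphB rmorphD !rmorphM. Qed.

End RingMorphism.

Section Ideals.
Variables (k : fieldType) (L : choiceType).
Local Notation F := (freealg k L).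
Implicit Types (rel : F -> Prop).

Lemma ideal_gen rel a f : rel f -> two_sided_ideal rel (a * f).
Proof.
by move=> rf; have := ideal_add a 1 rf (ideal_0 rel); rewrite mulr1 addr0.
Qed.

Lemma ideal_rel rel f : rel f -> two_sided_ideal rel f.
Proof. by move/(ideal_gen 1); rewrite mul1r. Qed.

Lemma ideal_D rel p q :
  two_sided_ideal rel p -> two_sided_ideal rel q -> two_sided_ideal rel (p + q).
Proof.
move=> + Iq; elim=> [|a f b {}p rf _ IHp]; first by rewrite add0r.
by rewrite -addrA; apply: ideal_add.
Qed.

Lemma ideal_M rel a b p :
  two_sided_ideal rel p -> two_sided_ideal rel (a * p * b).
Proof.
elim=> [|c f d {}p rf _ IHp]; first by rewrite mulr0 mul0r; apply: ideal_0.
have -> : a * (c * f * d + p) * b = (a * c) * f * (d * b) + a * p * b.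
  exact: mul_add_mul.
exact: ideal_add.
Qed.

Lemma ideal_trans rel rel' p : (forall f, rel f -> two_sided_ideal rel' f) ->
  two_sided_ideal rel p -> two_sided_ideal rel' p.
Proof.
move=> sub; elim=> [|a f b {}p /sub rf _ IHp]; first exact: ideal_0.
by apply: ideal_D => //; apply: ideal_M.
Qed.

Lemma ideal_kernel rel (A : algType k) (phi : {lrmorphism F -> A}) p :
  (forall f, rel f -> phi f = 0) -> two_sided_ideal rel p -> phi p = 0.
Proof.
move=> ker; elim=> [|a f b {}p /ker rf _ IHp]; first exact: raddf0.
by rewrite rmorphD !rmorphM /= rf mulr0 mul0r IHp addr0.
Qed.

Lemma left_ideal_annihilates (A : algType k) (rel : A -> Prop) (W : lmodType A)
    (v : W) a :
  (forall f, rel f -> f *: v = 0) -> left_ideal rel a -> a *: v = 0.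
Proof.
move=> ker; elim=> [|b f {}a /ker rf _ IHa]; first exact: scale0r.
by rewrite scalerDl -scalerA rf scaler0 IHa addr0.
Qed.

Lemma left_ideal_sub (A : algType k) (rel rel' : A -> Prop) a :
  (forall f, rel f -> rel' f) -> left_ideal rel a -> left_ideal rel' a.
Proof.
move=> sub; elim=> [|b f {}a /sub rf _ IHa]; first exact: left_ideal_0.
exact: left_ideal_add.
Qed.

End Ideals.

(** Converts the action of a commutator into the relation of a swap rule with correction term
    [r]. *)
Lemma com_scale (A : nzRingType) (W : lmodType A) (v : W) (a b c r : A) :
  com a b *: (c *: v) = r *: v -> (a * (b * c) - (b * (a * c) + r)) *: v = 0.
Proof.
rewrite scalerA /com mulrBl -!mulrA => e.
by rewrite opprD addrA scalerBl e subrr.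
Qed.

Section LocalitySums.
Variables (k : fieldType) (V : lmodType k) (g : int -> int -> V).

Lemma locality_sum0 n m :
  \sum_(s < 1) ((-1) ^+ s * 'C(0, s)%:R) *: g (n - s%:Z) (m + s%:Z) = g n m.
Proof. by rewrite big_ord1 bin0 mulr1 expr0 scale1r subr0 addr0. Qed.

Lemma locality_sum1 n m :
  \sum_(s < 2) ((-1) ^+ s * 'C(1, s)%:R) *: g (n - s%:Z) (m + s%:Z)
    = g n m - g (n - 1) (m + 1).
Proof.
rewrite big_ord_recr big_ord1 /= bin0 binn !mulr1 expr0 expr1 scale1r.
by rewrite subr0 addr0 scaleN1r.
Qed.

End LocalitySums.

(** * The rules present the mode algebra and the module [W] *)

Section ModeAlgebra.
Variable k : fieldType.
Local Notation F := (freealg k (modes xy)).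
Local Notation S := (@algebra_rules k).
Local Notation modeI := (two_sided_ideal (mode_algebra_rel Nxy)).
Local Notation x n := (@gen k xy X_ n).
Local Notation y n := (@gen k xy Y_ n).
Local Notation T := (genT k xy).

Lemma mode_locality z t n m : mode_algebra_rel Nxy
  (if z == t then comm (@gen k xy z n) (gen k t m)
   else comm (gen k z n) (gen k t m)
          - comm (gen k z (n - 1)) (gen k t (m + 1))).
Proof.
have := rel_locality k Nxy z t n m; rewrite /Nxy; case: (z == t).
  by rewrite (locality_sum0 (fun a b => comm (gen k z a) (gen k t b))).
by rewrite (locality_sum1 (fun a b => comm (gen k z a) (gen k t b))).
Qed.

(** The shifted indices are variables tied by equations, so the relation can be read from either of
    its two ends. *)
Lemma mode_locality_xy n m n' m' : n' = n - 1 -> m' = m + 1 ->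
  mode_algebra_rel Nxy (comm (x n) (y m) - comm (x n') (y m')).
Proof. by move=> -> ->; apply: (mode_locality X_ Y_ n m). Qed.

Section Rearrangements.
Implicit Types (p q r : F) (rel : F -> Prop).

Lemma ideal_mon2 rel (a b : modes xy) r :
  two_sided_ideal rel (mon k [:: a] * mon k [:: b] - r) ->
  two_sided_ideal rel (<< FMonom [:: a; b] >> - r).
Proof. by rewrite monM. Qed.

Lemma ideal_derivation rel p q r :
  rel (comm p q + r) -> two_sided_ideal rel (p * q - (q * p - r)).
Proof.
move/ideal_rel; congr (two_sided_ideal _ _).
by rewrite /comm opprB addrA addrAC.
Qed.

Lemma ideal_locality rel p q p' q' :
  rel (comm p q - comm p' q') ->
  two_sided_ideal rel (p * q - (q * p + comm p' q')).
Proof. by move: (comm p' q') => c; rewrite opprD addrA; apply: ideal_rel. Qed.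

Lemma ideal_locality_sym rel p q p' q' :
  rel (comm p' q' - comm p q) ->
  two_sided_ideal rel (q * p - (p * q + comm q' p')).
Proof.
move/ideal_rel; congr (two_sided_ideal _ _).
have eq_sub (V : zmodType) (a b c d : V) : c - d - (a - b) = b - (a + (d - c)).
  by rewrite opprB opprD opprB [LHS]addrC -addrA.
exact: eq_sub.
Qed.

End Rearrangements.

Lemma algebra_rules_ideal f : rules_rel S f -> modeI f.
Proof.
case=> w [r [rule ->]]; case: rule => [n|n|n m _|n m _|n m _|n m _];
  apply: ideal_mon2.
- by apply: ideal_derivation; apply: rel_derivation.
- by apply: ideal_derivation; apply: rel_derivation.
- by apply: ideal_rel; apply: (mode_locality X_ X_).
- by apply: ideal_rel; apply: (mode_locality Y_ Y_).
- by apply: ideal_locality; apply: mode_locality_xy.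
- by apply: ideal_locality_sym; apply: mode_locality_xy; lia.
Qed.

Variables (A : algType k) (phi : {lrmorphism F -> A}).
Hypothesis hA : presents_algebra (rules_rel S) phi.

Section AbstractWords.
Implicit Types (p q : F).

Lemma phi_comm p q : phi (comm p q) = com (phi p) (phi q).
Proof. exact: rmorph_com. Qed.

Lemma phi_rule2 (a b : modes xy) r : S (FMonom [:: a; b]) r ->
  phi (mon k [:: a]) * phi (mon k [:: b]) = phi r.
Proof.
move=> Sr; rewrite -rmorphM monM; apply/eqP.
rewrite -subr_eq0 -raddfB; apply/eqP/(proj2 hA)/ideal_rel.
by exists (FMonom [:: a; b]), r.
Qed.

Lemma com_swap p q : phi p * phi q = phi (q * p) -> com (phi p) (phi q) = 0.
Proof. by rewrite /com => ->; rewrite rmorphM subrr. Qed.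

Lemma com_derivation p q c r : phi p * phi q = phi (q * p - c *: r) ->
  com (phi p) (phi q) = - (c *: phi r).
Proof.
rewrite /com => ->; rewrite rmorphB rmorphM addrAC subrr add0r.
by congr (- _); apply: linearZ.
Qed.

Lemma com_locality p q p' q' : phi p * phi q = phi (q * p + comm p' q') ->
  com (phi p) (phi q) = com (phi p') (phi q').
Proof.
rewrite {1}/com => ->; rewrite rmorphD rmorphM addrAC subrr add0r.
exact: phi_comm.
Qed.

End AbstractWords.

Let op z n := phi (gen k z n).

Lemma op_com_same z n m : com (op z n) (op z m) = 0.
Proof.
wlog lt_mn : n m / m < n.
  move=> IH; case: (ltgtP m n) => [lt_mn|lt_nm|->]; last exact: subrr.
    exact: IH.
  by apply: com_flip0; apply: IH.
by case: z; apply: com_swap; apply: phi_rule2; constructor.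
Qed.

Lemma op_com_T z n : com (phi T) (op z n) = - (n%:~R *: op z (n - 1)).
Proof. by apply: com_derivation; apply: phi_rule2; case: z; constructor. Qed.

(** For [n > m + 1] this is the rule for [x(n) y(m)]. Otherwise [n' + 1 <= m'], and the rule for
    [y(m') x(n')] gives the same identity with both commutators reversed. *)
Lemma op_com_xy n m n' m' : n' = n - 1 -> m' = m + 1 ->
  com (op X_ n) (op Y_ m) = com (op X_ n') (op Y_ m').
Proof.
move=> dn dm; have [lt_mn|le_nm] := ltP (m + 1) n.
  by rewrite dn dm; apply: com_locality; apply: phi_rule2; apply: S_xy.
suff e : com (op Y_ m') (op X_ n') = com (op Y_ m) (op X_ n).
  exact: com_flip (esym e).
have -> : m = m' - 1 by lia.
have -> : n = n' + 1 by lia.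
by apply: com_locality; apply: phi_rule2; apply: S_yx; lia.
Qed.

(** The kernel of [phi] is the ideal of the rules. Each rule lies in the ideal of the mode
    relations; conversely it suffices that [phi] kills these relations. *)
Lemma presents_mode_algebra : presents_algebra (mode_algebra_rel Nxy) phi.
Proof.
split=> [|p]; first exact: (proj1 hA).
split=> [/(proj2 hA)|]; first exact/ideal_trans/algebra_rules_ideal.
apply: ideal_kernel => {p} _ [z n|z t n m].
  rewrite raddfD [X in _ + X]linearZ; apply/eqP; rewrite addr_eq0; apply/eqP.
  by apply: etrans (phi_comm _ _) _; apply: op_com_T.
rewrite /Nxy; case: eqP => [->|neq].
  rewrite (locality_sum0 (fun a b => comm (gen k t a) (gen k t b))).
  by apply: etrans (phi_comm _ _) _; apply: op_com_same.
rewrite (locality_sum1 (fun a b => comm (gen k z a) (gen k t b))).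
rewrite raddfB; apply/eqP; rewrite subr_eq0; apply/eqP.
apply: etrans (phi_comm _ _) _; apply: etrans (esym (phi_comm _ _)).
case: z t neq => [] [] neq; [by case: neq|exact: op_com_xy| |by case: neq].
apply: com_flip; apply: esym.
by apply: op_com_xy; lia.
Qed.

Hypothesis char0 : [pchar k] =i pred0.
Variables (W : lmodType A) (one : W).
Hypothesis hW : presents_module (@W_rel k) phi one.

Lemma W_rel_vac p : W_rel p -> phi p *: one = 0.
Proof.
move=> Wp; apply/(proj2 hW); rewrite -[phi p]mul1r -[_ * _]addr0.
by apply: left_ideal_add (left_ideal_0 _); exists p.
Qed.

Lemma xycom_word p (u : seq (xy * int)) :
  xycom op p *: (phi (mon k (map (@Some _) u)) *: one)
    = (p == -1)%:R *: (phi (mon k (map (@Some _) u)) *: one).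
Proof.
have vac z n : 0 <= n -> op z n *: one = 0.
  by move=> n_ge0; case: z; apply: W_rel_vac; [apply: W_x|apply: W_y].
have xy_vac : (op X_ 0 * op Y_ (-1)) *: one = one.
  have := W_rel_vac (W_xy k); rewrite rmorph_mulB1 scalerBl scale1r.
  by move/eqP; rewrite subr_eq0 => /eqP.
have [_ reg] := regular_word op_com_same (fun n m => op_com_xy erefl erefl)
  op_com_T char0 vac (W_rel_vac (W_T k)) xy_vac u.
suff -> : phi (mon k (map (@Some _) u)) *: one
    = foldr (fun z v => op z.1 z.2 *: v) one u by apply: reg.
elim: u {reg} => [|[z n] u IHu] /=; first by rewrite mon_nil rmorph1 scale1r.
rewrite -IHu.
apply: etrans (esym (scalerA _ _ _)); congr (_ *: _).
by apply: etrans (rmorphM phi _ _); congr (phi _); apply/esym/monM.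
Qed.

Lemma swap_vac (p q t r : F) :
  com (phi p) (phi q) *: (phi t *: one) = phi r *: one ->
  phi (p * (q * t) - (q * (p * t) + r)) *: one = 0.
Proof.
move=> e; have -> := rmorph_swap phi p q t r.
exact: com_scale.
Qed.

Lemma swap_word (a b : modes xy) s r :
  com (phi (mon k [:: a])) (phi (mon k [:: b])) *: (phi (mon k s) *: one)
    = phi r *: one ->
  phi (<< FMonom [:: a, b & s] >> - (mon k [:: b, a & s] + r)) *: one = 0.
Proof.
have mon3 c d : mon k [:: c, d & s] = mon k [:: c] * (mon k [:: d] * mon k s).
  by apply: esym; apply: etrans (congr1 _ (monM _ _ _)) (monM _ _ _).
move/swap_vac; apply: etrans; congr (phi _ *: _).
exact: (f_equal2 (fun u v => u - (v + r)) (mon3 a b) (mon3 b a)).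
Qed.

(** The exchange rules involve -c_(2m) and c_(2m+1). The index is -1 only for c_(2m+1) with
    [m = -1], which produces the extra term [u]. *)
Lemma W_rules_vac w r : vacuum_rules w r \/ W_rules w r ->
  phi (<< w >> - r) *: one = 0.
Proof.
case=> [[|z n n_ge0]|].
- by rewrite subr0; apply: W_rel_vac; apply: W_T.
- by rewrite subr0; case: z; apply: W_rel_vac; [apply: W_x|apply: W_y].
case=> [n n_ge0|n n_ge0|||m u _|m u _ m_neq|u _].
- by rewrite subr0; apply: W_rel_vac; apply: W_x.
- by rewrite subr0; apply: W_rel_vac; apply: W_y.
- by rewrite subr0; apply: W_rel_vac; apply: W_T.
- rewrite -[<< _ >>](monM k [:: mode X_ 0] [:: mode Y_ (-1)]).
  by apply: W_rel_vac; apply: W_xy.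
- rewrite -[mon _ _]addr0; apply: swap_word; rewrite raddf0 scale0r.
  have -> : com (phi (y m)) (phi (x m)) = - xycom op (m + m).
    by rewrite -(com_xy (fun n m => op_com_xy erefl erefl)) comN.
  rewrite scaleNr xycom_word; have /negbTE-> : m + m != -1 by lia.
  by rewrite scale0r oppr0.
- rewrite -[mon _ _]addr0; apply: swap_word; rewrite raddf0 scale0r.
  have -> : com (phi (x (m + 1))) (phi (y m)) = xycom op (m + 1 + m).
    by rewrite -(com_xy (fun n m => op_com_xy erefl erefl)).
  rewrite xycom_word; have /negbTE-> : m + 1 + m != -1 by lia.
  by rewrite scale0r.
- apply: swap_word; apply: etrans (xycom_word (-1) u) _.
  by rewrite eqxx scale1r.
Qed.

(** The defining relations of [W] occur among the rules, and every rule already holds in [W]. *)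
Lemma presents_W :
  presents_module (rules_rel (fun w r => vacuum_rules w r \/ W_rules w r))
    phi one.
Proof.
split=> [|a]; first exact: (proj1 hW).
split=> [/(proj2 hW)|].
  apply: left_ideal_sub => {a} _ [p Wp ->]; exists p => //.
  case: Wp => [n le0n|n le0n||].
  - exists (FMonom [:: mode X_ n]), 0; rewrite subr0; split=> //.
    by right; constructor.
  - exists (FMonom [:: mode Y_ n]), 0; rewrite subr0; split=> //.
    by right; constructor.
  - exists (FMonom [:: modeT]), 0; rewrite subr0; split=> //.
    by right; constructor.
  - exists (FMonom [:: mode X_ 0; mode Y_ (-1)]), 1; split.
      by right; constructor.
    by congr (_ - _); apply: monM.
apply: left_ideal_annihilates => {a} _ [_ [w [r [Rwr ->]]] ->].
exact: W_rules_vac.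
Qed.

End ModeAlgebra.

(** * Derivations of polynomial rings *)

Section LinearExtension.
Variables (k : fieldType) (K : choiceType) (V : lmodType k) (g : K -> V).
Implicit Types (p q : {malg k[K]}).

Definition lext p : V := \sum_(m <- msupp p) p@_m *: g m.

Lemma lextEw (d : {fset K}) p :
  msupp p `<=` d -> lext p = \sum_(m <- d) p@_m *: g m.
Proof.
move=> le; rewrite [LHS](big_fset_incl _ le) => //= m _ /mcoeff_outdom->.
exact: scale0r.
Qed.

Lemma lextD p q : lext (p + q) = lext p + lext q.
Proof.
rewrite (lextEw (msuppD_le p q)) (lextEw (fsubsetUl (msupp p) (msupp q))).
rewrite (lextEw (fsubsetUr (msupp p) (msupp q))) -big_split /=.
by apply: eq_bigr => m _; rewrite mcoeffD scalerDl.
Qed.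

Lemma lextZ c p : lext (c *: p) = c *: lext p.
Proof.
rewrite (lextEw (msuppZ_le c p)) scaler_sumr.
by apply: eq_bigr => m _; rewrite mcoeffZ scalerA.
Qed.

Lemma lextB p q : lext (p - q) = lext p - lext q.
Proof. by rewrite -[- q]scaleN1r lextD lextZ scaleN1r. Qed.

Lemma lext0 : lext 0 = 0.
Proof. by rewrite -(scale0r (0 : {malg k[K]})) lextZ scale0r. Qed.

Lemma lextU m : lext << m >> = g m.
Proof.
by rewrite (lextEw (@msuppU_le _ _ m 1)) big_seq_fset1 mcoeffUU scale1r.
Qed.

End LinearExtension.

Lemma scaleU (k : fieldType) (K : choiceType) (c : k) (m : K) :
  c *: << m >> = << c *g m >> :> {malg k[K]}.
Proof. by apply/malgP => m'; rewrite mcoeffZ !mcoeffU mulrnAr mulr1. Qed.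

Lemma malg_span (k : fieldType) (K : choiceType) (Q : {malg k[K]} -> Prop) :
  Q 0 -> (forall c m p, Q p -> Q (c *: << m >> + p)) -> forall p, Q p.
Proof.
move=> Q0 QD p; rewrite (monalgE p).
elim: (enum_fset (msupp p)) => [|m s IHs]; first by rewrite big_nil.
by rewrite big_cons -scaleU; apply: QD.
Qed.

Lemma sum_leibniz (R : nzRingType) (I : Type) (s : seq I) (F G H : I -> R) a b :
  (forall i, F i = G i * b + a * H i) ->
  \sum_(i <- s) F i = (\sum_(i <- s) G i) * b + a * \sum_(i <- s) H i.
Proof.
move=> e; rewrite mulr_suml mulr_sumr -big_split /=.
by apply: eq_bigr => i _; apply: e.
Qed.

Lemma scale_mul_term (k : fieldType) (P : comAlgType k) (c : k) (p u v d : P) :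
  c = 0 \/ p = u * v -> c *: (p * d) = c *: (u * d) * v.
Proof.
by case=> ->; rewrite ?scale0r ?mul0r // -scalerAl mulrAC.
Qed.

Lemma scale_natD (k : fieldType) (V : lmodType k) (v u w : V) m n :
  m%:R *: v = u -> n%:R *: v = w -> (m + n)%:R *: v = u + w.
Proof. by move=> <- <-; rewrite natrD scalerDl. Qed.

Section Leibniz.
Variables (k : fieldType) (P : algType k) (D : P -> P).
Hypothesis D_lin : forall c p q, D (c *: p + q) = c *: D p + D q.
Local Notation leibniz p q := (D (p * q) = D p * q + p * D q).

Lemma leibniz_linl c u p q :
  leibniz u q -> leibniz p q -> leibniz (c *: u + p) q.
Proof.
move=> Du Dp; rewrite mulrDl -scalerAl !D_lin Du Dp !mulrDl scalerDr.
by rewrite -!scalerAl addrACA.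
Qed.

Lemma leibniz_linr c u p q :
  leibniz p u -> leibniz p q -> leibniz p (c *: u + q).
Proof.
move=> Du Dp; rewrite mulrDr -scalerAr !D_lin Du Dp !mulrDr scalerDr.
by rewrite -!scalerAr addrACA.
Qed.

Lemma D_lin0 : D 0 = 0.
Proof. by have := D_lin (-1) 0 0; rewrite scaler0 addr0 scaleN1r addNr. Qed.

Lemma leibniz0l q : leibniz 0 q.
Proof. by rewrite !mul0r D_lin0 mul0r addr0. Qed.

Lemma leibniz0r p : leibniz p 0.
Proof. by rewrite !mulr0 D_lin0 mulr0 addr0. Qed.

Lemma leibniz1 : leibniz 1 1 -> D 1 = 0.
Proof.
rewrite !mulr1 mul1r => /eqP.
by rewrite -subr_eq0 opprD addNKr oppr_eq0 => /eqP.
Qed.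

Lemma leibniz_eq0 p q : leibniz p q -> D p = 0 -> D q = 0 -> D (p * q) = 0.
Proof. by move=> -> -> ->; rewrite mul0r mulr0 addr0. Qed.

End Leibniz.

Section Derivations.
Variables (k : fieldType) (I : choiceType).
Local Notation K := {cmonom I}.
Local Notation P := {malg k[K]}.
Implicit Types (d : I -> P) (m : K) (p q : P).

Lemma cmonom_ind (Q : K -> Prop) :
  Q mone -> (forall i m, Q m -> Q (mmul (ucm i) m)) -> forall m, Q m.
Proof.
move=> Q1 QM m; have [n le_n] := ubnP (mdeg m).
elim: n m le_n => // n IHn m le_n.
have [->|] := eqVneq m mone; first exact: Q1.
move=> m_neq1; have /fset0Pn[i i_m] : finsupp m != fset0.
  apply: contraNneq m_neq1 => m0; apply/cmP => i.
  by rewrite cm1; apply/eqP; rewrite cmE_eq0 m0.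
have def_m : m = mmul (ucm i) (divcm m (ucm i)).
  apply/eqP/cmP=> j; rewrite cmM divcmE cmU; case: eqP => [<-|_] /=.
    by rewrite add1n subn1 prednK // lt0n cmE_neq0.
  by rewrite add0n subn0.
by rewrite def_m; apply/QM/IHn; move: le_n; rewrite {1}def_m mdegM mdegU.
Qed.

(** The sum over the variables of the partial derivative of [m] times [d i]: the value at [m] of the
    derivation sending each variable [i] to [d i]. *)
Definition dmonom d m : P :=
  \sum_(i <- finsupp m) (m i)%:R *: (<< divcm m (ucm i) >> * d i).

Lemma dmonomEw (D : {fset I}) d m : finsupp m `<=` D ->
  dmonom d m = \sum_(i <- D) (m i)%:R *: (<< divcm m (ucm i) >> * d i).
Proof.
move=> le; rewrite [LHS](big_fset_incl _ le) => //= i _; rewrite -cmE_eq0.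
by move/eqP->; apply: scale0r.
Qed.

Lemma dmonomM d m m' :
  dmonom d (mmul m m') = dmonom d m * << m' >> + << m >> * dmonom d m'.
Proof.
rewrite (@dmonomEw (finsupp m `|` finsupp m') _ m) ?fsubsetUl //.
rewrite (@dmonomEw (finsupp m `|` finsupp m') _ m') ?fsubsetUr //.
rewrite (@dmonomEw (finsupp m `|` finsupp m') _ (mmul m m')) ?mdomD //.
apply: sum_leibniz => i.
(* Division of exponents is truncated, so it commutes with multiplication by [b] only when [i]
   occurs in [a]; otherwise the coefficient [a i] is 0. *)
have div_term (a b : K) : (a i)%:R *: (<< divcm (mmul a b) (ucm i) >> * d i)
    = (a i)%:R *: (<< divcm a (ucm i) >> * d i) * << b >>.
  apply: scale_mul_term; have [->|a_neq0] := eqVneq (a i) 0%N; [by left|right].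
  rewrite mulU; apply: (congr1 (fun w => << w >>)).
  apply/eqP/cmP=> j; rewrite cmM !divcmE cmM cmU; case: eqP => [<-|_] /=.
    by rewrite addnC -addnBA ?lt0n // addnC.
  by rewrite !subn0.
rewrite cmM; apply: scale_natD; first exact: div_term.
by rewrite [mmul m m']mulmC; apply: etrans (div_term _ _) (mulrC _ _).
Qed.

Definition der d : P -> P := lext (dmonom d).

Lemma der_lin d c p q : der d (c *: p + q) = c *: der d p + der d q.
Proof. by rewrite /der lextD lextZ. Qed.

Lemma der_leibniz d p q : der d (p * q) = der d p * q + p * der d q.
Proof.
elim/malg_span: p => [|c m p IHp]; first exact: leibniz0l (der_lin d) q.
apply: (leibniz_linl (der_lin d)); last exact: IHp.
elim/malg_span: q {IHp} => [|a m' q IHq]; first exact: leibniz0r (der_lin d) _.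
apply: (leibniz_linr (der_lin d)); last exact: IHq.
apply: etrans (congr1 (der d) (mulU k m m')) _.
apply: etrans (lextU _ _) _; apply: etrans (dmonomM _ _ _) _.
exact: (f_equal2 (fun u v => u * << m' >> + << m >> * v)
  (esym (lextU _ m)) (esym (lextU _ m'))).
Qed.

Lemma der_U d i : der d << ucm i >> = d i.
Proof.
rewrite [LHS]lextU /dmonom mdomU big_seq_fset1 cmUU scale1r.
have -> : divcm (ucm i) (ucm i) = mone.
  by apply/eqP/cmP=> j; rewrite divcmE cm1 subnn.
by apply: mul1r.
Qed.

Lemma derivation_eq0 (E : P -> P) :
  (forall c p q, E (c *: p + q) = c *: E p + E q) ->
  (forall p q, E (p * q) = E p * q + p * E q) ->
  (forall i, E << ucm i >> = 0) -> forall p, E p = 0.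
Proof.
move=> lin leib EU; have E_lin0 := D_lin0 lin.
apply: malg_span => [//|c m p IHp]; rewrite lin IHp addr0.
suff -> : E << m >> = 0 by apply: scaler0.
elim/cmonom_ind: m => [|i m IHm]; first exact: leibniz1 (leib 1 1).
exact: etrans (congr1 E (esym (mulU k _ _)))
  (leibniz_eq0 (leib _ _) (EU i) IHm).
Qed.

End Derivations.

(** * The Fock space *)

Section FockSpace.
Variables (k : fieldType) (P : comAlgType k).
Local Notation I := (xy * int)%type.
Variables (U : I -> P) (der : (I -> P) -> P -> P).
Implicit Types (p q : P) (a b : I).
Local Notation is_linear E :=
  (forall (c : k) p q, E (c *: p + q) = c *: E p + E q).
Local Notation leibniz E := (forall p q, E (p * q) = E p * q + p * E q).
Hypothesis der_lin : forall d, is_linear (der d).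
Hypothesis der_leibniz : forall d, leibniz (der d).
Hypothesis der_U : forall d a, der d (U a) = d a.
Hypothesis derivation_eq0 : forall E : P -> P,
  is_linear E -> leibniz E -> (forall a, E (U a) = 0) -> forall p, E p = 0.

Lemma derZ d c p : der d (c *: p) = c *: der d p.
Proof.
have der0 : der d 0 = 0.
  by have := der_lin d (-1) 0 0; rewrite scaler0 addr0 scaleN1r addNr.
by have := der_lin d c p 0; rewrite !addr0 der0 addr0.
Qed.

Lemma derD d p q : der d (p + q) = der d p + der d q.
Proof. by have := der_lin d 1 p q; rewrite !scale1r. Qed.

Lemma der1 d : der d 1 = 0.
Proof.
have /eqP := der_leibniz d 1 1.
by rewrite !mulr1 mul1r -subr_eq0 opprD addNKr oppr_eq0 => /eqP.
Qed.

Lemma derC d c : der d c%:A = 0.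
Proof. by rewrite derZ der1 scaler0. Qed.

Lemma derN d p : der d (- p) = - der d p.
Proof. by rewrite -!scaleN1r derZ. Qed.

(** The commutator of two derivations is a derivation, so it may be compared with [E] on the
    generators alone. *)
Lemma commutator_der d1 d2 E : is_linear E -> leibniz E ->
  (forall a, der d1 (d2 a) - der d2 (d1 a) = E (U a)) ->
  forall p, der d1 (der d2 p) - der d2 (der d1 p) = E p.
Proof.
move=> E_lin E_leib E_U p; apply/eqP; rewrite -subr_eq0; apply/eqP.
move: p; apply: derivation_eq0 => [c p q|p q|a].
- rewrite !der_lin E_lin !scalerBr !opprD !addrA.
  by rewrite [LHS](ACl (1*3*5*2*4*6)%AC).
- by rewrite !der_leibniz !derD !der_leibniz E_leib; ring.
- by rewrite !der_U E_U subrr.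
Qed.

(** The skew form of the Weyl algebra: the scalar by which the commutator of two modes acts, with
    [x(n), y(m)] equal to 1 for n + m = -1. *)
Definition omega a b : k :=
  if a.2 + b.2 == -1 then
    match a.1, b.1 with X_, Y_ => 1 | Y_, X_ => -1 | _, _ => 0 end
  else 0.

(** The values on the variables of the translation derivation, as dictated by [T, z(n)] = -n
    z(n-1). *)
Definition shift a : P := - (a.2%:~R *: U (a.1, a.2 - 1)).

Definition pairing a b : P := (omega a b)%:A.

(* x(n) and y(n) multiply by a variable for n < 0, and for n >= 0 they
   differentiate along y(-1-n) and -x(-1-n). *)
Definition act (l : modes xy) p : P :=
  if l is Some a then if a.2 < 0 then U a * p else der (pairing a) p
  else der shift p.

Lemma act_lin l : is_linear (act l).
Proof.
move=> c p q; case: l => [a|] /=; last exact: der_lin.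
by case: ifP => _; [rewrite mulrDr scalerAr|apply: der_lin].
Qed.

Lemma omegaC a b : omega a b = - omega b a.
Proof.
rewrite /omega addrC; case: eqP => _; last by rewrite oppr0.
by case: a.1; case: b.1; rewrite ?oppr0 ?opprK.
Qed.

Lemma omega_neg a b : a.2 < 0 -> b.2 < 0 -> omega a b = 0.
Proof. by rewrite /omega => a_lt0 b_lt0; case: eqP => //; lia. Qed.

Lemma omega_nneg a b : 0 <= a.2 -> 0 <= b.2 -> omega a b = 0.
Proof. by rewrite /omega => a_ge0 b_ge0; case: eqP => //; lia. Qed.

(** Two multiplications commute, a derivation and a multiplication give the pairing by the Leibniz
    rule, and two derivations with scalar values on the variables commute. *)
Lemma act_comm a b p :
  act (Some a) (act (Some b) p) - act (Some b) (act (Some a) p)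
    = omega a b *: p.
Proof.
rewrite /=; case: (ltP a.2 0) => [a_lt0|a_ge0];
  case: (ltP b.2 0) => [b_lt0|b_ge0].
- by rewrite omega_neg // scale0r mulrCA subrr.
- rewrite der_leibniz der_U omegaC scaleNr /pairing mulr_algl.
  by rewrite opprD addrA addrAC subrr add0r.
- by rewrite der_leibniz der_U /pairing mulr_algl addrK.
- rewrite omega_nneg // scale0r.
  move: p; apply: commutator_der => [c p q|p q|c].
  + by rewrite scaler0 addr0.
  + by rewrite mul0r mulr0 addr0.
  + by rewrite /pairing !derC subrr.
Qed.

Lemma act_T a p :
  act None (act (Some a) p) - act (Some a) (act None p)
    = - (a.2%:~R *: act (Some (a.1, a.2 - 1)) p).
Proof.
rewrite /=; case: (ltP a.2 0) => [a_lt0|a_ge0].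
  have -> : a.2 - 1 < 0 by lia.
  by rewrite der_leibniz der_U addrK /shift mulNr scalerAl.
(* Index 0 is separate because the lowered mode -1 is a multiplication, not a derivation; its
   coefficient there is 0. *)
case: (eqVneq a.2 0) => [a0|a_neq0].
  rewrite a0 scale0r oppr0; move: p; apply: commutator_der => [c p q|p q|c].
  - by rewrite scaler0 addr0.
  - by rewrite mul0r mulr0 addr0.
  - rewrite /pairing derC sub0r /shift derN opprK derZ der_U /pairing.
    rewrite /omega a0 /=.
    (* The pairing can be nonzero only at [c.2 = 0], where the coefficient [c.2] of the shift
       vanishes. *)
    have -> : (0 + (c.2 - 1) == -1 :> int) = (c.2 == 0) by lia.
    by case: eqP => [->|_]; rewrite ?scale0r ?scaler0.
have /negbTE-> : ~~ (a.2 - 1 < 0) by lia.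
move: p; apply: commutator_der => [c p q|p q|c].
- by rewrite der_lin scalerDr opprD scalerN !scalerA mulrC.
- by rewrite der_leibniz scalerDr opprD mulNr mulrN scalerAl scalerAr.
- rewrite /pairing derC sub0r /shift derN opprK derZ !der_U /pairing /omega /=.
  (* Both pairings live at [c.2 = - a.2], where the coefficient [c.2] from the shift is the required
     [- a.2]. *)
  have -> : (a.2 + (c.2 - 1) == -1 :> int) = (c.2 == - a.2) by lia.
  have -> : (a.2 - 1 + c.2 == -1 :> int) = (c.2 == - a.2) by lia.
  case: eqP => [->|_]; last by rewrite !scale0r !scaler0 oppr0.
  by rewrite mulrNz scaleNr.
Qed.

Lemma act_vac z n : 0 <= n -> act (Some (z, n)) 1 = 0.
Proof. by move=> n_ge0; rewrite /= ltNge n_ge0 /= der1. Qed.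

Lemma act_T_vac : act None 1 = 0.
Proof. exact: der1. Qed.

End FockSpace.

(** * Confluence *)

Section Evaluation.
Variables (k : fieldType) (L : choiceType) (V : lmodType k) (act : L -> V -> V).
Hypothesis act_lin :
  forall l c u v, act l (c *: u + v) = c *: act l u + act l v.
Local Notation F := (freealg k L).

Definition ev (p : F) (v : V) : V := lext (fun w : word L => foldr act v w) p.

Lemma foldr_act_lin (w : seq L) c u v :
  foldr act (c *: u + v) w = c *: foldr act u w + foldr act v w.
Proof. by elim: w => //= l w ->; apply: act_lin. Qed.

Lemma foldr_act0 (w : seq L) : foldr act 0 w = 0.
Proof.
by have := foldr_act_lin w (-1) 0 0; rewrite scaler0 addr0 scaleN1r addNr.
Qed.

Lemma evU (w : word L) v : ev << w >> v = foldr act v w.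
Proof. exact: lextU. Qed.

Lemma evB p q v : ev (p - q) v = ev p v - ev q v.
Proof. exact: lextB. Qed.

Lemma evD p q v : ev (p + q) v = ev p v + ev q v.
Proof. exact: lextD. Qed.

Lemma evZ c p v : ev (c *: p) v = c *: ev p v.
Proof. exact: lextZ. Qed.

Lemma ev0 v : ev 0 v = 0.
Proof. exact: lext0. Qed.

Lemma ev_UM (w : word L) q v : ev (<< w >> * q) v = foldr act (ev q v) w.
Proof.
elim/malg_span: q => [|c u q IHq]; first by rewrite mulr0 !ev0 foldr_act0.
have -> : << w >> * (c *: << u >> + q) = c *: << mmul w u >> + << w >> * q.
  apply: etrans (mulrDr _ _ _) _; apply: (congr1 (fun t => t + << w >> * q)).
  rewrite !scaleU; apply: etrans (fgmulUU _ _ _ _) _.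
  by rewrite mul1r.
rewrite evD evZ IHq evU fmM foldr_cat [ev (_ + q) v]evD evZ evU.
by rewrite foldr_act_lin.
Qed.

Lemma evM p q v : ev (p * q) v = ev p (ev q v).
Proof.
elim/malg_span: p => [|c w p IHp]; first by rewrite mul0r !ev0.
have -> : (c *: << w >> + p) * q = c *: (<< w >> * q) + p * q.
  by rewrite mulrDl -scalerAl.
by rewrite evD evZ ev_UM IHp evD evZ evU.
Qed.

(** An algebra rule is applied with a word to its right, so it has to hold on every vector; a module
    rule only acts on the generator [v]. *)
Lemma edge_ev (S R : rules k L) (v : V) :
  (forall f r u, S f r -> ev (<< f >> - r) u = 0) ->
  (forall f r, R f r -> ev (<< f >> - r) v = 0) ->
  forall h g, edge S R h g -> ev h v = ev g v.
Proof.
move=> evS evR h _ [w1 f w2 r Sfr _|w1 f r Rfr _].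
  rewrite evB evZ evM ev_UM (evS _ _ _ Sfr) foldr_act0.
  by rewrite scaler0 subr0.
by rewrite evB evZ ev_UM (evR _ _ Rfr) foldr_act0 scaler0 subr0.
Qed.

End Evaluation.

Section RuleEvaluation.
Variables (k : fieldType) (X : choiceType) (V : lmodType k).
Variable act : modes X -> V -> V.
Hypothesis act_lin :
  forall l c u v, act l (c *: u + v) = c *: act l u + act l v.
Local Notation ev := (ev act).
Local Notation mon := (mon k).
Implicit Types (a b c : modes X) (v : V).

Lemma ev_mon s v : ev (mon s) v = foldr act v s.
Proof. exact: evU. Qed.

Lemma ev_mon2 a b v : ev (mon [:: a] * mon [:: b]) v = act a (act b v).
Proof. by rewrite monM ev_mon. Qed.

Lemma ev_one v : ev 1 v = v.
Proof. by rewrite -mon_nil ev_mon. Qed.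

Lemma ev_comm a b v :
  ev (comm (mon [:: a]) (mon [:: b])) v = act a (act b v) - act b (act a v).
Proof.
apply: etrans (evB _ _ _ _) _.
exact: (f_equal2 (fun u w => u - w) (ev_mon2 _ _ _) (ev_mon2 _ _ _)).
Qed.

Lemma ev_swap a b v : act a (act b v) - act b (act a v) = 0 ->
  ev (<< FMonom [:: a; b] >> - mon [:: b] * mon [:: a]) v = 0.
Proof. by move=> e; rewrite evB evU ev_mon2. Qed.

Lemma ev_derivation a b e (x : k) v :
  act a (act b v) - act b (act a v) = - (x *: act e v) ->
  ev (<< FMonom [:: a; b] >> - (mon [:: b] * mon [:: a] - x *: mon [:: e])) v
    = 0.
Proof.
move=> E; rewrite evB evU evB ev_mon2 evZ ev_mon /=.
by rewrite opprB addrA addrAC E addNr.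
Qed.

Lemma ev_locality a b a' b' v :
  act a (act b v) - act b (act a v) = act a' (act b' v) - act b' (act a' v) ->
  ev (<< FMonom [:: a; b] >>
      - (mon [:: b] * mon [:: a] + comm (mon [:: a']) (mon [:: b']))) v = 0.
Proof.
move=> E; rewrite evB evU evD ev_mon2 ev_comm /=.
by rewrite opprD addrA E subrr.
Qed.

Lemma ev_swap_word a b s r v :
  act a (act b (foldr act v s)) - act b (act a (foldr act v s)) = ev r v ->
  ev (<< FMonom [:: a, b & s] >> - (mon [:: b, a & s] + r)) v = 0.
Proof.
move=> E; rewrite evB evU evD ev_mon /=.
by rewrite opprD addrA E subrr.
Qed.

End RuleEvaluation.

(** * The polynomial representation and its values on normal words *)

Section FockModel.
Variable k : fieldType.
Local Notation I := (xy * int)%type.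
Local Notation P := {malg k[{cmonom I}]}.
Local Notation S := (@algebra_rules k).
Local Notation R := (fun w r => vacuum_rules w r \/ @W_rules k w r).

(** Variables are indexed by all modes; the words applied to 1 span the polynomials in the negative
    ones, which form the Fock space. *)
Let U (a : I) : P := << ucm a >>.
Let op := act U (@der k I).

Lemma op_lin l c (u v : P) : op l (c *: u + v) = c *: op l u + op l v.
Proof. exact: act_lin (@der_lin k I) _ _ _ _. Qed.

Lemma op_comm a b (p : P) :
  op (Some a) (op (Some b) p) - op (Some b) (op (Some a) p) = omega k a b *: p.
Proof.
exact: act_comm (@der_lin k I) (@der_leibniz k I) (@der_U k I)
  (@derivation_eq0 k I) a b p.
Qed.

Lemma op_T a (p : P) :
  op None (op (Some a) p) - op (Some a) (op None p)
    = - (a.2%:~R *: op (Some (a.1, a.2 - 1)) p).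
Proof.
exact: act_T (@der_lin k I) (@der_leibniz k I) (@der_U k I)
  (@derivation_eq0 k I) a p.
Qed.

Lemma op_vac z n : 0 <= n -> op (Some (z, n)) 1 = 0.
Proof. exact: act_vac (@der_leibniz k I) _ _. Qed.

Lemma op_T_vac : op None 1 = 0.
Proof. exact: act_T_vac (@der_leibniz k I). Qed.

Lemma omega_xy n m : omega k (X_, n) (Y_, m) = (n + m == -1)%:R.
Proof. by rewrite /omega /=; case: eqP. Qed.

Lemma algebra_rules_ev f r v : S f r -> ev op (<< f >> - r) v = 0.
Proof.
case=> [n|n|n m _|n m _|n m _|n m _].
- by apply: ev_derivation; apply: (op_T (X_, n)).
- by apply: ev_derivation; apply: (op_T (Y_, n)).
- apply: ev_swap; apply: etrans (op_comm _ _ _) _.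
  by rewrite /omega /= if_same scale0r.
- apply: ev_swap; apply: etrans (op_comm _ _ _) _.
  by rewrite /omega /= if_same scale0r.
- apply: ev_locality; apply: etrans (op_comm _ _ _) _.
  apply: etrans (esym (op_comm _ _ _)); rewrite !omega_xy.
  by have -> : n - 1 + (m + 1) = n + m by lia.
- apply: ev_locality; apply: etrans (op_comm _ _ _) _.
  apply: etrans (esym (op_comm _ _ _)).
  rewrite omegaC omega_xy [in RHS]omegaC omega_xy.
  by have -> : n + 1 + (m - 1) = n + m by lia.
Qed.

Lemma module_rules_ev f r : R f r -> ev op (<< f >> - r) 1 = 0.
Proof.
case=> [[|z n n_ge0]|].
- by rewrite subr0; apply: etrans (evU _ _ _) _; apply: op_T_vac.
- by rewrite subr0; apply: etrans (evU _ _ _) _; apply: op_vac.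
case=> [n n_ge0|n n_ge0|||m u _|m u _ m_neq|u _].
- by rewrite subr0; apply: etrans (evU _ _ _) _; apply: op_vac.
- by rewrite subr0; apply: etrans (evU _ _ _) _; apply: op_vac.
- by rewrite subr0; apply: etrans (evU _ _ _) _; apply: op_T_vac.
(* Since [x(0)] kills 1, the product [y(-1) x(0)] does too, and the commutator alone gives the value
   of [x(0) y(-1)] on 1. *)
- have op0 l : op l 0 = 0.
    by have := op_lin l (-1) 0 0; rewrite scaler0 addr0 scaleN1r addNr.
  rewrite evB ev_one evU; have := op_comm (X_, 0) (Y_, -1) 1.
  rewrite (op_vac X_ (lexx 0)) op0 subr0 omega_xy scale1r => e.
  by apply: etrans (congr1 (fun t => t - 1) e) _; apply: subrr.
- rewrite -[mon _ _]addr0; apply: ev_swap_word; rewrite ev0.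
  apply: etrans (op_comm _ _ _) _; rewrite omegaC omega_xy.
  have /negbTE-> : m + m != -1 by lia.
  by rewrite oppr0 scale0r.
- rewrite -[mon _ _]addr0; apply: ev_swap_word; rewrite ev0.
  apply: etrans (op_comm _ _ _) _; rewrite omega_xy.
  have /negbTE-> : m + 1 + m != -1 by lia.
  by rewrite scale0r.
- apply: ev_swap_word; apply: etrans (op_comm _ _ _) _; rewrite omega_xy.
  by rewrite eqxx scale1r; apply: esym; apply: ev_mon.
Qed.

Definition cmonom_word (u : seq I) : {cmonom I} :=
  foldr (fun a m => mmul (ucm a) m) mone u.

Lemma cmonom_wordE u a : cmonom_word u a = count_mem a u.
Proof. by elim: u => [|b u IHu] /=; rewrite ?cm1 // cmM cmU IHu. Qed.

(** [ordered_step] is the comparison of keys, hence an order, and a sorted word is determined by its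
    multiset of letters. *)
Lemma ordered_word_perm u v : ordered_word u -> ordered_word v ->
  perm_eq u v -> u = v.
Proof.
case/andP=> [su _] /andP[sv _]; apply: (@sorted_eq _ ordered_step) su sv.
  move=> [z n] [t m] [s l] /andP[/= le1 lt1] /andP[/= le2 lt2].
  by rewrite /ordered_step /=; case: z t s lt1 lt2 => [] [] []; rewrite /=; lia.
move=> [z n] [t m] /andP[/andP[/= le1 lt1] /andP[/= le2 lt2]].
case: z t lt1 lt2 => [] [] /= lt1 lt2; try lia.
  by congr (_, _); lia.
by congr (_, _); lia.
Qed.

Lemma ev_word u : ordered_word u ->
  foldr op 1 (map (@Some _) u) = << cmonom_word u >> :> P.
Proof.
case/andP=> _; elim: u => [|a u IHu] //= /andP[a_lt0 /IHu ->].
by rewrite /op /act a_lt0; apply: mulU.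
Qed.

(** A normal word evaluates to the monomial of its letters, and distinct normal words give distinct
    monomials, so the coefficients of [h] can be read off its value. *)
Lemma ev_normal_eq0 (h : freealg k (modes xy)) :
  all (fun w : word _ => normal_word w) (msupp h) -> ev op h 1 = 0 -> h = 0.
Proof.
move=> /allP nh ev_h; apply/eqP; rewrite -msupp_eq0; apply/eqP/fsetP => w.
rewrite in_fset0; apply/negP => wh; have /normal_wordP[u ou def_w] := nh w wh.
have : (ev op h 1)@_(cmonom_word u) = h@_w.
  rewrite /ev /lext raddf_sum (big_fsetD1 w) //= big1_fset => [|v].
    by rewrite addr0 mcoeffZ def_w ev_word // mcoeffUU mulr1.
  rewrite in_fsetD1 => /andP[vw vh] _.
  have /normal_wordP[u' ou' def_v] := nh v vh.
  rewrite mcoeffZ def_v ev_word // mcoeffU.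
  case: eqP => [e|_]; last exact: mulr0.
  case/eqP: vw; apply/eqP; rewrite fmP def_v def_w; apply/eqP; congr map.
  apply: ordered_word_perm => //; rewrite /perm_eq; apply/allP => a _ /=.
  by rewrite -!cmonom_wordE e.
by rewrite ev_h mcoeff0 => /esym/eqP; rewrite mcoeff_eq0 wh.
Qed.

Lemma algebra_rules_lt_context w1 f w2 r g : S f r -> g \in msupp r ->
  word_lt (mmul (mmul w1 g) w2) (mmul (mmul w1 f) w2).
Proof. by move=> Sfr gr; apply/word_lt_context/(algebra_rules_lt Sfr). Qed.

Lemma module_rules_lt_context w1 f r g : R f r -> g \in msupp r ->
  word_lt (mmul w1 g) (mmul w1 f).
Proof.
(* A module rule is the case of an empty right context. *)
move=> Rfr gr; rewrite -[mmul w1 g]mulm1 -[mmul w1 f]mulm1.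
exact/word_lt_context/(module_rules_lt Rfr).
Qed.

Lemma terminating_W : terminating S R.
Proof.
exact: terminating_of_lt wf_word_lt algebra_rules_lt_context
  module_rules_lt_context.
Qed.

Lemma normal_or_reducible (w : word (modes xy)) : ~~ normal_word w ->
  (exists w1 f w2 r, S f r /\ w = mmul (mmul w1 f) w2) \/
  (exists w1 f r, R f r /\ w = mmul w1 f).
Proof.
case/(@seq_reducible k)=> [[w1 [f [w2 [r [Sfr e]]]]]|[w1 [f [r [Rfr e]]]]].
- by left; exists (FMonom w1), f, (FMonom w2), r; split=> //; apply: eq_mmul3.
- by right; exists (FMonom w1), f, r; split=> //; apply: eq_mmul.
Qed.

Lemma diamond_W : diamond S R.
Proof.
apply: (@diamond_of_invariant _ _ _ _ _ wf_word_lt algebra_rules_lt_context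
  module_rules_lt_context (fun w => normal_word w) normal_or_reducible P
  (fun p => ev op p 1)).
- by move=> p q; apply: evB.
- apply: edge_ev; first exact: op_lin.
  + exact: algebra_rules_ev.
  + exact: module_rules_ev.
- exact: ev_normal_eq0.
Qed.

End FockModel.

Theorem theorem1 (k : fieldType) (hk : [pchar k] =i pred0)
    (A : algType k) (phi : {lrmorphism freealg k (modes xy) -> A})
    (hA : presents_algebra (rules_rel (@algebra_rules k)) phi)
    (W : lmodType A) (one : W)
    (hW : presents_module (@W_rel k) phi one) :
  vertex_GS_basis Nxy (@algebra_rules k) phi one (@W_rules k).
Proof.
split; first exact: presents_mode_algebra.
split; [exact: hA | exact: presents_W | exact: terminating_W | exact: diamond_W].
Qed.
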